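(* Let $\kappa \ge 2$ be an integer. For every integer $N \ge 1$ and every real $\beta \ge 0$, we have $$F_N(\beta) \ge \left( \frac{N-1}{N} \right)^{3/2} \frac{2\beta}{3 \sqrt{\pi}}$$ (where $\pi$ on the right-hand side is the number $3.14159\ldots$), and $$\inf_{\pi \in \Pi_{(\frac 1 \kappa, \ldots, \frac 1 \kappa)}} \mathscr{P}_\beta(\pi) \le \log \kappa + \frac{\beta^2}{2\kappa}.$$ In particular, if (with $\pi = 3.14159\ldots$) $$\frac{\kappa}{\log \kappa} > \frac{9\pi}{2} \quad \text{ and } \quad \left|\frac{3\sqrt{\pi}}{2\kappa} \beta - 1\right|^2 < 1- \frac{9\pi \log \kappa}{2\kappa},$$ then it is not the case that $F_N(\beta)$ converges to $\inf_{\pi \in \Pi_{(\frac 1 \kappa, \ldots, \frac 1 \kappa)}} \mathscr{P}_\beta(\pi)$ as $N \to \infty$.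
   Context: Potts spin glass. Let $\kappa \ge 2$ and $N \ge 1$ be integers, and let $(g_{ij})_{i,j\ge 1}$ be independent centered Gaussian random variables of variance $1$. For $\sigma \in \{1,\ldots,\kappa\}^N$, set $$H_N(\sigma) := \frac{1}{\sqrt N} \sum_{i,j=1}^N g_{ij} \mathbf{1}_{\{\sigma_i = \sigma_j\}},$$ and for $\beta \ge 0$ define the free energy $$F_N(\beta) := \frac 1 N \mathbb{E} \log \sum_{\sigma \in \{1,\ldots,\kappa\}^N} \exp(\beta H_N(\sigma)).$$ Paths. Let $S^\kappa_+$ be the set of $\kappa \times \kappa$ real symmetric positive semidefinite matrices, and let $\mathscr{D} := \{(d_1,\ldots,d_\kappa) \in [0,1]^\kappa : \sum_{k=1}^\kappa d_k = 1\}$. For $d \in \mathscr{D}$, let $\Pi_d$ be the set of paths $\pi : [0,1] \to S^\kappa_+$ that are left-continuous, non-decreasing (meaning that $\pi(v) - \pi(u) \in S^\kappa_+$ for all $u \le v$ in $[0,1]$), and satisfy $\pi(0) = 0$ and $\pi(1) = \mathrm{diag}(d_1,\ldots,d_\kappa)$. The functional $\mathscr{P}_\beta$ (Panchenko's Parisi-type functional for the Potts spin glass). Let $d \in \mathscr{D}$ and $\lambda = (\lambda_1,\ldots,\lambda_\kappa) \in \mathbb{R}^\kappa$. Consider first a step path $\pi \in \Pi_d$: there are an integer $r \ge 1$, numbers $0 = x_{-1} \le x_0 < x_1 < \cdots < x_{r-1} < x_r = 1$, and matrices $0 = \gamma_0 \le \gamma_1 \le \cdots \le \gamma_r = \mathrm{diag}(d_1,\ldots,d_\kappa)$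 in $S^\kappa_+$ (with $\gamma_p - \gamma_{p-1} \in S^\kappa_+$) such that $\pi(0) = 0$ and $\pi(u) = \gamma_p$ for $x_{p-1} < u \le x_p$, $0 \le p \le r$. Let $z_1,\ldots,z_r$ be independent centered Gaussian vectors $z_p = (z_p(k))_{1\le k\le \kappa}$ in $\mathbb{R}^\kappa$ with covariance matrix $\mathrm{Cov}(z_p) = 2(\gamma_p - \gamma_{p-1})$. Define $$X_r := \log \sum_{k=1}^\kappa \exp\Big(\lambda_k + \beta \sum_{p=1}^r z_p(k)\Big),$$ and recursively, for $p = r-1, r-2, \ldots, 0$, $$X_p := \frac{1}{x_p} \log \mathbb{E}_{z_{p+1}} \exp(x_p X_{p+1}),$$ where $\mathbb{E}_{z_{p+1}}$ denotes the expectation with respect to $z_{p+1}$ only; if $x_p = 0$ (which can only happen for $p = 0$), this is interpreted as $X_p := \mathbb{E}_{z_{p+1}} X_{p+1}$. Then $X_0$ is deterministic, and one sets $$\mathscr{P}_\beta(\lambda, \pi) := X_0 - \sum_{k=1}^\kappa \lambda_k d_k - \frac{\beta^2}{2} \sum_{p=0}^{r-1} x_p \left( \|\gamma_{p+1}\|_{HS}^2 - \|\gamma_p\|_{HS}^2 \right),$$ where $\|\gamma\|_{HS}^2 = \sum_{k,k'} \gamma_{kk'}^2$. For fixed $\lambda$ and $d$, the map $\pi \mapsto \mathscr{P}_\beta(\lambda,\pi)$ on step paths depends only on $\pi$ and is Lipschitz continuous with respect to the $L^1$ distance $\int_0^1 \|\pi(u)-\pi'(u)\|_{HS}\, du$;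 it is extended by continuity to all of $\Pi_d$. Finally, for $\pi \in \Pi_d$, $$\mathscr{P}_\beta(\pi) := \inf_{\lambda \in \mathbb{R}^\kappa} \mathscr{P}_\beta(\lambda,\pi).$$ *)

(* Defs.v *)
From HB Require Import structures.
From mathcomp Require Import all_boot all_order all_algebra.
From mathcomp Require Import all_classical all_reals all_analysis.

Set Implicit Arguments.
Unset Strict Implicit.
Unset Printing Implicit Defensive.

Import Order.TTheory GRing.Theory Num.Theory.
Import numFieldNormedType.Exports.

Local Open Scope classical_set_scope.
Local Open Scope ring_scope.

Section GaussianDisorder.
Context {d : measure_display} {T : measurableType d} {R : realType}.
Variable P : probability T R.

Definition mutually_independent (I : eqType) (X : I -> {RV P >-> R}) : Prop :=
  forall (s : seq I) (A : I -> set R),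
    uniq s -> (forall i, measurable (A i)) ->
    P (\big[setI/setT]_(i <- s) (X i @^-1` A i)) =
    (\prod_(i <- s) P (X i @^-1` A i))%E.

(* Only measurable sets are compared: [normal_prob 0 1] and the pushforward of
   [P] are unrelated on non-measurable sets. *)
Definition standard_normal (X : {RV P >-> R}) : Prop :=
  forall A : set R, measurable A -> distribution P X A = normal_prob 0 1 A.

(* The indices i, j >= 1 of the array are shifted to start from 0, and the
   colours 1, ..., kappa are the elements of 'I_kappa. *)
Definition potts_hamiltonian (g : nat -> nat -> {RV P >-> R}) (kappa N : nat)
    (sigma : {ffun 'I_N -> 'I_kappa}) (w : T) : R :=
  (Num.sqrt N%:R)^-1 *
  \sum_(i < N) \sum_(j < N) g i j w * (sigma i == sigma j)%:R.

Definition potts_free_energy (g : nat -> nat -> {RV P >-> R})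
    (kappa N : nat) (beta : R) : \bar R :=
  ((N%:R^-1)%:E *
   'E_P[fun w => ln (\sum_(sigma : {ffun 'I_N -> 'I_kappa})
                       expR (beta * potts_hamiltonian g sigma w))])%E.

End GaussianDisorder.

Section ParisiFunctional.
Context {R : realType}.

Section Paths.
Variable kappa : nat.
Implicit Types (A : 'M[R]_kappa) (q : R -> 'M[R]_kappa) (d : 'rV[R]_kappa).

Definition psdmx A : Prop :=
  A^T = A /\ forall v : 'rV[R]_kappa, 0 <= (v *m A *m v^T) 0 0.

Definition hs_norm2 A : R := \sum_k \sum_l A k l ^+ 2.

Definition hs_norm A : R := Num.sqrt (hs_norm2 A).

(* Paths are functions on the whole of R of which only the restriction to
   [0, 1] matters. *)
Definition path_set d : set (R -> 'M[R]_kappa) :=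
  [set q | [/\ forall u, 0 <= u <= 1 -> psdmx (q u),
               forall u, 0 < u <= 1 -> q v @[v --> u^'-] --> q u,
               forall u v, 0 <= u -> u <= v -> v <= 1 -> psdmx (q v - q u),
               q 0 = 0
             & q 1 = diag_mx d]].

Definition path_dist q q' : \bar R :=
  (\int[lebesgue_measure]_(u in `[0%R, 1%R]) (hs_norm (q u - q' u))%:E)%E.

(* [sx s p] and [sgamma s p] are meaningful for p <= sr s only; the convention
   x_{-1} = 0 is built into [step_valid] and [step_path]. *)
Record step_data := StepData {
  sr : nat;
  sx : nat -> R;
  sgamma : nat -> 'M[R]_kappa
}.

Definition step_valid d (s : step_data) : Prop :=
  [/\ (1 <= sr s)%N,
      0 <= sx s 0%N /\ (forall p, (p < sr s)%N -> sx s p < sx s p.+1),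
      sx s (sr s) = 1,
      (forall p, (p <= sr s)%N -> psdmx (sgamma s p)) /\
      (forall p, (p < sr s)%N -> psdmx (sgamma s p.+1 - sgamma s p))
    & sgamma s 0%N = 0 /\ sgamma s (sr s) = diag_mx d].

(* The value at u is gamma_p for the least p <= r with u <= x_p. *)
Definition step_path (s : step_data) (u : R) : 'M[R]_kappa :=
  sgamma s (find (fun p => u <= sx s p) (iota 0 (sr s))).

Lemma sx_incr d (s : step_data) (p p' : nat) : step_valid d s ->
  (p <= p')%N -> (p' <= sr s)%N -> sx s p <= sx s p'.
Proof.
case=> _ [_ xS] _ _ _; elim: p' => [|p' IH]; first by rewrite leqn0 => /eqP ->.
rewrite leq_eqVlt => /orP[/eqP -> //|pp'] p'r.
by apply: le_trans (ltW (xS _ p'r)); apply: IH => //; exact: ltnW.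
Qed.

Lemma step_pathE d (s : step_data) (p : nat) (u : R) : step_valid d s ->
  (p <= sr s)%N -> (if p is p'.+1 then sx s p' else 0) < u -> u <= sx s p ->
  step_path s u = sgamma s p.
Proof.
move=> vs pr xu ux; rewrite /step_path; congr sgamma.
have bef i : (i < p)%N -> (u <= sx s i) = false.
  move=> ip; apply/negbTE; rewrite -ltNge; case: p pr xu ux ip => // p' pr xu _ ip.
  by apply: le_lt_trans xu; apply: (sx_incr vs) => //; exact: ltnW.
have -> : sr s = (p + (sr s - p))%N by rewrite subnKC.
rewrite iotaD find_cat add0n size_iota ifN; last first.
  by apply/hasPn => i; rewrite mem_iota /= add0n => /bef ->.
by case: (sr s - p)%N => [|m] /=; rewrite ?ux addn0.
Qed.

Lemma step_path0 d (s : step_data) : step_valid d s -> step_path s 0 = 0.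
Proof.
by case: s => -[|r] x gamma [] //= _ [x0 _] _ _ [g0 _]; rewrite /step_path /= x0.
Qed.

End Paths.

(* Expectation of f(xi) for xi a standard Gaussian vector of R^n, as an
   iterated integral over the n independent coordinates. *)
Fixpoint std_gauss_expectation (n : nat) : ('rV[R]_n -> R) -> R :=
  match n with
  | 0%N => fun f => f 0
  | m.+1 => fun f =>
      \int[normal_prob 0 1]_t
        std_gauss_expectation (fun v : 'rV[R]_m => f (row_mx (t%:M : 'rV[R]_1) v))
  end.

(* Expectation of f(z) for z a centered Gaussian vector with covariance matrix
   C: z is xi A, where xi is standard and A^T A = C. Such an A exists as soon
   as C is positive semidefinite, and the law of xi A depends on C only. *)
Definition gauss_expectation (n : nat) (C : 'M[R]_n) (f : 'rV[R]_n -> R) : R :=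
  let A := xget 0 [set A : 'M[R]_n | A^T *m A = C] in
  std_gauss_expectation (fun xi => f (xi *m A)).

Section Functional.
Variable kappa : nat.
Implicit Types (beta : R) (d lambda : 'rV[R]_kappa).

(* [parisi_X beta lambda s j y] is X_p for p = r - j, on the event
   z_1 + ... + z_p = y: X_p depends on z_1, ..., z_p through their sum only. *)
Fixpoint parisi_X beta lambda (s : step_data kappa) (j : nat)
    (y : 'rV[R]_kappa) : R :=
  match j with
  | 0%N => ln (\sum_k expR (lambda 0 k + beta * y 0 k))
  | i.+1 =>
      let p := (sr s - i.+1)%N in
      let C := 2%:R *: (sgamma s p.+1 - sgamma s p) in
      if sx s p == 0 then
        gauss_expectation C (fun z => parisi_X beta lambda s i (y + z))
      else
        (sx s p)^-1 * ln (gauss_expectation C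
          (fun z => expR (sx s p * parisi_X beta lambda s i (y + z))))
  end.

Definition parisi_step beta d lambda (s : step_data kappa) : R :=
  parisi_X beta lambda s (sr s) 0 - \sum_k lambda 0 k * d 0 k
  - beta ^+ 2 / 2 *
    \sum_(p < sr s) sx s p * (hs_norm2 (sgamma s p.+1) - hs_norm2 (sgamma s p)).

Definition step_nbhs d (q : R -> 'M[R]_kappa) : set_system (step_data kappa) :=
  filter_from [set e : R | 0 < e]
    (fun e => [set s | step_valid d s /\ (path_dist (step_path s) q < e%:E)%E]).

(* Extension by continuity from the step paths to all the paths of [path_set d].
   When q is itself a step path, its own representations belong to every set
   of [step_nbhs d q], so that the limit is the value at these. *)
Definition parisi_lambda beta d lambda (q : R -> 'M[R]_kappa) : R :=
  lim (parisi_step beta d lambda s @[s --> step_nbhs d q]).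

Definition parisi beta d (q : R -> 'M[R]_kappa) : \bar R :=
  ereal_inf [set (parisi_lambda beta d lambda q)%:E | lambda in setT].

Definition parisi_inf beta d : \bar R :=
  ereal_inf [set parisi beta d q | q in path_set d].

End Functional.

End ParisiFunctional.

(* Main.v *)
From HB Require Import structures.
Require Import Defs.
From mathcomp Require Import all_boot all_order all_algebra.
From mathcomp Require Import all_classical all_reals all_analysis.
From mathcomp Require Import measurable_realfun.
From mathcomp Require Import ring lra.

Import Order.TTheory GRing.Theory Num.Theory.
Import numFieldNormedType.Exports.

Local Open Scope classical_set_scope.
Local Open Scope ring_scope.

Set Implicit Arguments.
Unset Strict Implicit.
Unset Printing Implicit Defensive.

(** The lower bound on the free energy uses two colours only, i.e. signs
    s_i = 1 or -1: since 1_{sigma_i = sigma_j} = (1 + s_i s_j) / 2, up to a centered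
    term the Hamiltonian is half of the Sherrington-Kirkpatrick energy
    N^{-1/2} sum_{i,j} g_ij s_i s_j.  The signs are chosen greedily, s_n being the
    sign of the local field L_n = sum_{i<n} (g_in + g_ni) s_i.  As s_0, ..., s_{n-1}
    are functions of the g_ij with i, j < n only, L_n is centered Gaussian of
    variance 2n, and E|L_n| = 2 sqrt(n / pi); then sum the square roots.

    The upper bound on the Parisi functional uses lambda = 0 and the paths equal to
    0 on [0, x] and to diag(1/kappa) on (x, 1], with x < 1 tending to 1: by
    concavity of t |-> t^x, X_0 <= log kappa + beta^2 / kappa, whereas the last term
    of the functional is x beta^2 / (2 kappa). *)

(** * The standard normal distribution *)

Import HBNNSimple.

(* Neither function has to be measurable: the integral of a nonnegative function
   is a supremum over the simple functions below it. *)
Lemma integral_mono d (T : measurableType d) (R : realType)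
    (mu : {measure set T -> \bar R}) (f h : T -> \bar R) :
  (forall x, (f x <= h x)%E) -> (\int[mu]_x f x <= \int[mu]_x h x)%E.
Proof.
move=> fh; rewrite /integral /= !patch_setT.
apply: leeB; apply: ereal_sup_le => _ [u uf <-]; exists u => // x;
  apply: le_trans (uf x) _.
  by apply: (@funepos_le _ _ setT) => //; rewrite inE.
by apply: (@funeneg_le _ _ setT) => //; rewrite inE.
Qed.

Section StandardNormal.
Context {R : realType}.
Local Notation mu := (@lebesgue_measure R).
Local Notation N01 := (@normal_prob R 0 1).

(** The Radon-Nikodym derivative of [normal_prob] agrees almost everywhere with [normal_pdf], since
    both have the same integral over every measurable set. *)
Lemma ge0_integral_normal_prob (m s : R) (f : R -> \bar R) :
  measurable_fun setT f -> (forall x, (0 <= f x)%E) ->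
  (\int[normal_prob m s]_x f x = \int[mu]_x (f x * (normal_pdf m s x)%:E))%E.
Proof.
move=> mf f0.
have dom := @normal_prob_dominates R m s.
have mg := measurable_int _ (Radon_Nikodym_SigmaFinite.f_integrable dom).
have mpdf : measurable_fun setT (fun x => (normal_pdf m s x)%:E).
  by apply/measurable_EFinP; exact: measurable_normal_pdf.
rewrite -(Radon_Nikodym_SigmaFinite.change_of_variables dom) //.
apply: ae_eq_integral => //.
- exact: emeasurable_funM.
- exact: emeasurable_funM.
apply: ae_eqe_mul2l; apply: integral_ae_eq => //.
  exact: Radon_Nikodym_SigmaFinite.f_integrable.
by move=> A _ mA; rewrite -Radon_Nikodym_SigmaFinite.f_integral.
Qed.

Lemma normal_pdf_std (x : R) :
  normal_pdf 0 1 x = (Num.sqrt (pi *+ 2))^-1 * expR (- x ^+ 2 / 2).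
Proof.
by rewrite normal_pdfE ?oner_neq0 // /normal_peak /normal_fun expr1n mul1r subr0.
Qed.

Lemma normal_pdf_affine (m s x : R) : 0 < s ->
  normal_pdf m s (m + s * x) * s = normal_pdf 0 1 x.
Proof.
move=> s0; rewrite normal_pdf_std normal_pdfE ?gt_eqF //.
rewrite /normal_peak /normal_fun -mulrnAr sqrtrM ?sqr_ge0 // sqrtr_sqr gtr0_norm //.
rewrite invfM mulrC !mulrA mulfV ?gt_eqF // mul1r.
congr (_ * expR _).
rewrite addrC addKr exprMn -[in LHS]mulr_natr; field; lra.
Qed.

(** Substitution u = m + s x on the whole line; the Jacobian s turns the density at u into the
    standard one. *)
Lemma ge0_integral_normal_affine (m s : R) (f : R -> R) : 0 < s ->
  continuous f -> (forall x, 0 <= f x) ->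
  (\int[normal_prob m s]_x (f x)%:E = \int[N01]_x (f (m + s * x))%:E)%E.
Proof.
move=> s0 cf f0.
have cF : continuous (fun x : R => m + s * x).
  by move=> x; apply: cvgD; [exact: cvg_cst|apply: cvgM; [exact: cvg_cst|exact: cvg_id]].
have mF := continuous_measurable_fun cF.
have mf := continuous_measurable_fun cf.
have dF x : is_derive x (1:R) (fun x : R => m + s * x) s.
  by apply: is_derive_eq; rewrite ?add0r ?scaler0 ?addr0 mul1r /GRing.scale /= mulr1.
have F'E : (fun x : R => m + s * x)^`()%classic = cst s.
  by apply/funext => x; rewrite derive1E derive_val.
rewrite ge0_integral_normal_prob; first last.
- by move=> x; rewrite lee_fin.
- exact/measurable_EFinP.
rewrite ge0_integral_normal_prob; first last.
- by move=> x; rewrite lee_fin.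
- by apply/measurable_EFinP; exact: (measurableT_comp mf).
under eq_integral do rewrite -EFinM.
rewrite (@increasing_ge0_integration_by_substitutionT _ (fun x : R => m + s * x)
  (fun x => f x * normal_pdf m s x)).
- apply: eq_integral => x _; rewrite F'E -(normal_pdf_affine m x s0) -EFinM.
  by rewrite mulrA.
- by move=> x y xy; rewrite ltrD2l ltr_pM2l.
- by rewrite F'E => x; exact: cvg_cst.
- by rewrite F'E; exact: is_cvg_cst.
- by rewrite F'E; exact: is_cvg_cst.
- by move=> x; exact: ex_derive.
- apply/cvgrNyPle => A; near=> x; rewrite -lerBrDl -ler_pdivlMl //.
- apply/cvgryPge => A; near=> x; rewrite -lerBlDl -ler_pdivrMl //.
- move=> x; apply: cvgM; first exact: cf.
  by apply: continuous_normal_pdf; rewrite gt_eqF.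
- by move=> x; rewrite mulr_ge0 // normal_pdf_ge0.
Unshelve. all: by end_near. Qed.

Lemma ge0_integral_normal_opp (f : R -> \bar R) :
  measurable_fun setT f -> (forall x, (0 <= f x)%E) ->
  (\int[N01]_x f (- x)%R = \int[N01]_x f x)%E.
Proof.
move=> mf f0.
have mo : measurable_fun setT (-%R : R -> R) by exact: measurable_funN.
have mfo : measurable_fun setT (fun x : R => f (- x)) by exact: measurableT_comp.
have mpdf : measurable_fun setT (fun x : R => (normal_pdf 0 1 x)%:E).
  by apply/measurable_EFinP; exact: measurable_normal_pdf.
rewrite !ge0_integral_normal_prob //.
transitivity (\int[pushforward mu (-%R : R -> measurableTypeR R)]_x
  (f x * (normal_pdf 0 1 x)%:E))%E; last first.
  by apply: eq_measure_integral => A mA _; exact: lebesgue_measureN.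
rewrite ge0_integral_pushforward; first last.
- by move=> x _; rewrite mule_ge0 // lee_fin normal_pdf_ge0.
- exact: emeasurable_funM.
- exact: measurableT.
- exact: mo.
by apply: eq_integral => x _; rewrite /= !normal_pdf_std sqrrN.
Qed.

Lemma integral_normal_abs : (\int[N01]_x `|x|%:E = (Num.sqrt (2 / pi))%:E)%E.
Proof.
rewrite ge0_integral_normal_prob //; last first.
  by apply/measurable_EFinP; exact: normr_measurable.
under eq_integral do rewrite -EFinM.
rewrite ge0_symfun_integralT; last first.
- by move=> x /=; rewrite normrN !normal_pdf_std sqrrN.
- move=> x; apply: cvgM; first exact: norm_continuous.
  by apply: continuous_normal_pdf; rewrite oner_neq0.
- by move=> x; rewrite mulr_ge0 // normal_pdf_ge0.
(* After folding onto the half-line by evenness, the integrand x phi(x) has the antiderivative -phi,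
   so the integral is 2 phi(0). *)
pose F (x : R) := - normal_pdf 0 1 x.
have dF (x : R) : is_derive x (1:R) F (x * normal_pdf 0 1 x).
  have -> : F = fun x => - ((Num.sqrt (pi *+ 2))^-1 * expR (- x ^+ 2 / 2)).
    by apply/funext => y; rewrite /F normal_pdf_std.
  apply: is_derive_eq.
  rewrite normal_pdf_std /GRing.scale /=; set e := expR _; set q := _^-1; field; exact: isT.
rewrite -set_itvcy.
rewrite [X in (2 * X)%E](_ : _ =
    \int[mu]_(x in `[0%R, +oo[) (x * normal_pdf 0 1 x)%:E)%E; last first.
  by apply: eq_integral => x; rewrite inE /= in_itv /= andbT => x0; rewrite ger0_norm.
have dF' x : derivable F x 1 by exact: ex_derive.
rewrite (@ge0_continuous_FTC2y _ _ F 0 0).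
- rewrite -EFinB sub0r opprK -EFinM; congr EFin.
  rewrite normal_pdf_std expr0n /= oppr0 mul0r expR0 mulr1.
  have q0 : 0 < Num.sqrt 2 :> R by rewrite sqrtr_gt0.
  have p0 : 0 < Num.sqrt pi :> R by rewrite sqrtr_gt0 pi_gt0.
  rewrite -[pi *+ 2]mulr_natl sqrtrM // sqrtrM // sqrtrV ?pi_ge0 //.
  rewrite -[X in X * _](@sqr_sqrtr _ 2) //; field.
  by rewrite !gt_eqF.
- by move=> x x0; rewrite mulr_ge0 // normal_pdf_ge0.
- apply: continuous_subspaceT => x; apply: cvgM; first exact: cvg_id.
  by apply: continuous_normal_pdf; rewrite oner_neq0.
- rewrite -[0]oppr0 -[X in - X](mulr0 (Num.sqrt (pi *+ 2))^-1).
  have -> : F = fun x => - ((Num.sqrt (pi *+ 2))^-1 * gauss_fun ((Num.sqrt 2)^-1 * x)).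
    apply/funext => y; rewrite /F normal_pdf_std /gauss_fun exprMn exprVn.
    by rewrite sqr_sqrtr // [_ * y ^+ 2]mulrC mulNr.
  apply: cvgN; apply: cvgM; first exact: cvg_cst.
  apply: cvg_comp; last exact: cvg_gauss_fun.
  by apply: gt0_cvgMry; [rewrite invr_gt0 sqrtr_gt0|exact: cvg_id].
- by move=> x _; exact: dF'.
- by apply: cvg_at_right_filter; apply: differentiable_continuous; apply/derivable1_diffP.
- by move=> x _; rewrite derive1E derive_val.
Qed.

End StandardNormal.

(** * Convolution of Gaussian laws *)

Section Convolution.
Context {R : realType}.
Local Notation mu := (@lebesgue_measure R).
Local Notation N01 := (@normal_prob R 0 1).

Lemma normal_pdf_gt0E (m s x : R) : 0 < s -> normal_pdf m s x =
  (s * Num.sqrt (pi *+ 2))^-1 * expR (- (x - m) ^+ 2 / (2 * s ^+ 2)).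
Proof.
move=> s0; rewrite normal_pdfE ?gt_eqF // /normal_peak /normal_fun.
by rewrite -mulrnAr sqrtrM ?sqr_ge0 // sqrtr_sqr gtr0_norm // mulr_natl.
Qed.

(** Bayes' rule for u = y + b x + a t, with x and t independent standard normal: the law of x times
    the law of u given x is the law of u times the law of x given u. The latter has mean b (u - y) /
    c^2 and standard deviation a / c. *)
Lemma normal_pdf_conv (y a b x u : R) (c := Num.sqrt (a ^+ 2 + b ^+ 2)) : 0 < a ->
  normal_pdf 0 1 x * normal_pdf (y + b * x) a u =
  normal_pdf y c u * normal_pdf (b * (u - y) / c ^+ 2) (a / c) x.
Proof.
move=> a0.
have c2 : c ^+ 2 = a ^+ 2 + b ^+ 2.
  by rewrite sqr_sqrtr // addr_ge0 // sqr_ge0.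
have c0 : 0 < c by rewrite sqrtr_gt0 ltr_wpDr // ?sqr_ge0 // exprn_gt0.
have q0 : 0 < Num.sqrt (pi *+ 2) :> R by rewrite sqrtr_gt0 mulrn_wgt0 // pi_gt0.
rewrite !normal_pdf_gt0E //; last by rewrite divr_gt0.
rewrite mulrACA [RHS]mulrACA -!expRD; congr (_ * expR _).
  field.
  by rewrite !gt_eqF.
rewrite expr_div_n c2; field.
by rewrite -c2 !gt_eqF // exprn_gt0.
Qed.

Lemma measurable_normal_pdf_kernel (y a b : R) : 0 < a ->
  measurable_fun setT (fun xu : R * R => normal_pdf (y + b * xu.1) a xu.2).
Proof.
move=> a0.
rewrite (_ : (fun _ => _) = fun xu : R * R => (a * Num.sqrt (pi *+ 2))^-1 *
    expR (- (xu.2 - (y + b * xu.1)) ^+ 2 / (2 * a ^+ 2))); last first.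
  by apply/funext => xu; rewrite normal_pdf_gt0E.
apply: measurable_funM => //; apply: measurableT_comp => //.
apply: measurable_funM => //; apply: measurableT_comp => //.
apply: measurable_funX; apply: measurable_funB => //.
by apply: measurable_funD => //; apply: measurable_funM.
Qed.

(** By Tonelli the integral over x can be done first; by [normal_pdf_conv] it is that of a
    conditional density, equal to 1, and only the law of u, of variance a^2 + b^2, remains. *)
Lemma normal_semigroup (f : R -> R) (y a b : R) : 0 < a ->
  continuous f -> (forall x, 0 <= f x) ->
  (\int[N01]_x \int[N01]_t (f (y + b * x + a * t))%:E =
   \int[N01]_x (f (y + Num.sqrt (a ^+ 2 + b ^+ 2) * x))%:E)%E.
Proof.
move=> a0 cf f0; set c := Num.sqrt _.
have c0 : 0 < c by rewrite sqrtr_gt0 ltr_wpDr // ?sqr_ge0 // exprn_gt0.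
have mf := continuous_measurable_fun cf.
have mK := measurable_normal_pdf_kernel y b a0.
have mG : measurable_fun setT
    (fun xu : R * R => (f xu.2 * normal_pdf (y + b * xu.1) a xu.2)%:E).
  apply/measurable_EFinP; apply: measurable_funM => //.
  exact: measurableT_comp.
have G0 (xu : R * R) : (0 <= (f xu.2 * normal_pdf (y + b * xu.1) a xu.2)%:E)%E.
  by rewrite lee_fin mulr_ge0 // normal_pdf_ge0.
have mpdf : measurable_fun setT (fun x : R => (normal_pdf 0 1 x)%:E).
  by apply/measurable_EFinP; exact: measurable_normal_pdf.
have inner (x : R) : (\int[N01]_t (f (y + b * x + a * t))%:E =
    \int[mu]_u (f u * normal_pdf (y + b * x) a u)%:E)%E.
  rewrite -(@ge0_integral_normal_affine R (y + b * x) a f) //.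
  rewrite ge0_integral_normal_prob //; first exact/measurable_EFinP.
rewrite -[RHS](ge0_integral_normal_affine y c0 cf f0).
rewrite [RHS]ge0_integral_normal_prob; first last.
- by move=> u; rewrite lee_fin.
- exact/measurable_EFinP.
under eq_integral do rewrite inner.
rewrite ge0_integral_normal_prob; first last.
- by move=> x; apply: integral_ge0 => u _; exact: (G0 (x, u)).
- exact: (@measurable_fun_fubini_tonelli_F _ _ _ _ _ mu _ mG G0).
have mG2 : measurable_fun setT (fun xu : R * R =>
    (f xu.2 * normal_pdf (y + b * xu.1) a xu.2)%:E * (normal_pdf 0 1 xu.1)%:E)%E.
  by apply: emeasurable_funM => //; exact: (measurableT_comp mpdf measurable_fst).
have G20 (xu : R * R) :
    (0 <= (f xu.2 * normal_pdf (y + b * xu.1) a xu.2)%:E * (normal_pdf 0 1 xu.1)%:E)%E.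
  by rewrite mule_ge0 // lee_fin normal_pdf_ge0.
transitivity (\int[mu]_x \int[mu]_u
    ((f u * normal_pdf (y + b * x) a u)%:E * (normal_pdf 0 1 x)%:E))%E.
  apply: eq_integral => x _; rewrite ge0_integralZr //.
  - apply/measurable_EFinP; apply: measurable_funM => //; exact: measurable_normal_pdf.
  - by move=> u _; exact: (G0 (x, u)).
  - by rewrite lee_fin normal_pdf_ge0.
have /= -> := @fubini_tonelli _ _ _ _ _ mu mu _ mG2 G20.
apply: eq_integral => u _ /=.
transitivity (\int[mu]_x ((f u * normal_pdf y c u)%:E *
    (normal_pdf (b * (u - y) / c ^+ 2) (a / c) x)%:E))%E.
  apply: eq_integral => x _; rewrite -!EFinM; congr EFin.
  by rewrite -[RHS]mulrA -normal_pdf_conv // mulrA mulrAC.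
rewrite ge0_integralZl //.
- by rewrite integral_normal_pdf mule1.
- by apply/measurable_EFinP; exact: measurable_normal_pdf.
- by move=> x _; rewrite lee_fin normal_pdf_ge0.
- by rewrite lee_fin mulr_ge0 // normal_pdf_ge0.
Qed.

(** Here [a] is the standard deviation of the Gaussian noise already integrated out around the value
    [y]. *)
Definition normal_abs (a y : R) : \bar R := \int[N01]_x `|y + a * x|%:E.

Lemma normal_abs_ge0 (a y : R) : (0 <= normal_abs a y)%E.
Proof. by apply: integral_ge0 => x _; rewrite lee_fin. Qed.

Lemma measurable_normal_abs (a : R) : measurable_fun setT (normal_abs a).
Proof.
have mf : measurable_fun setT (fun yx : R * R => `|yx.1 + a * yx.2|%:E).
  apply/measurable_EFinP; apply: measurableT_comp => //.
  by apply: measurable_funD => //; apply: measurable_funM.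
by apply: (@measurable_fun_fubini_tonelli_F _ _ _ _ _ N01 _ mf) => yx; rewrite lee_fin.
Qed.

Lemma normal_abs0 (a : R) : 0 <= a ->
  normal_abs a 0 = (a * Num.sqrt (2 / pi))%:E.
Proof.
move=> a0; rewrite /normal_abs.
under eq_integral do rewrite add0r normrM EFinM.
rewrite ge0_integralZl //.
- by rewrite integral_normal_abs ger0_norm.
- by apply/measurable_EFinP; exact: normr_measurable.
Qed.

Lemma normal_absE0 (y : R) : normal_abs 0 y = `|y|%:E.
Proof.
rewrite /normal_abs; under eq_integral do rewrite mul0r addr0.
have /= N1 := @probability_setT _ _ _ N01.
by rewrite (integral_cst N01 measurableT) /= N1 mule1.
Qed.

Lemma normal_abs_sign (a b y : R) : 0 <= a -> b ^+ 2 = 1 ->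
  (\int[N01]_x normal_abs a (y + b * x)%R = normal_abs (Num.sqrt (a ^+ 2 + 1)) y)%E.
Proof.
rewrite le_eqVlt => /predU1P[<-|a0] b1; last first.
  have := @normal_semigroup (fun x => `|x|) y a b a0 (@norm_continuous _ R^o)
    (fun x => normr_ge0 x).
  by rewrite b1.
(* The case a = 0, outside the scope of [normal_semigroup]: the sign b is removed by the symmetry of
   the law. *)
rewrite expr0n /= add0r sqrtr1.
under eq_integral do rewrite normal_absE0.
have mf : measurable_fun setT (fun x : R => `|y + 1 * x|%:E).
  apply/measurable_EFinP; apply: measurableT_comp => //.
  by apply: measurable_funD => //; apply: measurable_funM.
move/eqP : b1; rewrite sqrf_eq1 => /orP[|] /eqP -> //.
rewrite /normal_abs -(ge0_integral_normal_opp mf) //.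
by apply: eq_integral => x _; rewrite mul1r mulN1r.
Qed.

(** Reflection exchanges the positive and negative parts of x, so their integrals, which are finite,
    cancel. *)
Lemma integral_normal_id :
  N01.-integrable setT (fun x : R => x%:E) /\ (\int[N01]_x x%:E = 0)%E.
Proof.
have mid : measurable_fun [set: R] (fun x : R => x%:E) by exact/measurable_EFinP.
have iid : N01.-integrable setT (fun x : R => x%:E).
  apply/integrableP; split => //.
  by under eq_integral do rewrite abse_EFin; rewrite integral_normal_abs ltry.
split => //; rewrite integralE.
rewrite -(ge0_integral_normal_opp (measurable_funeneg mid)) //.
rewrite [X in (_ - X)%E](_ : _ = \int[N01]_x (fun x : R => x%:E)^\+ x)%E.
  by rewrite subee //; exact: integrable_pos_fin_num.
by apply: eq_integral => x _; rewrite funenegE funeposE -EFinN opprK.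
Qed.


End Convolution.

(** * Independence *)

Section FrozenVariable.
Context {d : measure_display} {T : measurableType d} {R : realType}.
Variable P : probability T R.
Variables (I : eqType) (X : I -> {RV P >-> R}).
Hypothesis X_indep : mutually_independent X.
Hypothesis X_normal : forall i, standard_normal (X i).

(** A pi-system generating the sigma-algebra of the X_i, i in s. Indexing [A] by all of [I] matches
    [mutually_independent]. *)
Definition cylinders (s : seq I) : set (set T) :=
  [set D | exists A : I -> set R, (forall i, measurable (A i)) /\
     D = [set w | forall i, i \in s -> A i (X i w)]].

(** The type [T] with this smaller sigma-algebra: measurability with respect to it becomes a type
    annotation on the function. *)
Definition generated (s : seq I) := g_sigma_algebraType (cylinders s).

Lemma cylinders_bigI (s : seq I) (A : I -> set R) :
  [set w | forall i, i \in s -> A i (X i w)] =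
  \big[setI/setT]_(i <- undup s) (X i @^-1` A i).
Proof.
under eq_set => w do under eq_forall => i do rewrite -mem_undup.
elim: (undup s) => [|j t IH].
  by rewrite big_nil; apply/seteqP.
rewrite big_cons -IH; apply/seteqP; split=> w /= h.
  by split=> [|i it]; apply: h; rewrite inE ?eqxx // it orbT.
by move=> i; rewrite inE => /predU1P[->|/h.2 //]; exact: h.1.
Qed.

Lemma measurable_preimage_RV (i : I) (A : set R) :
  measurable A -> measurable (X i @^-1` A).
Proof. by move=> mA; rewrite -[_ @^-1` _]setTI; exact: (measurable_funP (X i)). Qed.

Lemma measurable_cylinders (s : seq I) : cylinders s `<=` measurable.
Proof.
move=> _ [A [mA ->]]; rewrite cylinders_bigI; apply: bigsetI_measurable => i _.
exact: measurable_preimage_RV.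
Qed.

Lemma measurable_generated (s : seq I) (D : set T) :
  <<s cylinders s >> D -> measurable D.
Proof.
apply: smallest_sub; last exact: measurable_cylinders.
exact: sigma_algebra_measurable.
Qed.

Lemma setI_closed_cylinders (s : seq I) : setI_closed (cylinders s).
Proof.
move=> _ _ [A [mA ->]] [B [mB ->]]; exists (fun i => A i `&` B i); split.
  by move=> i; exact: measurableI.
apply/seteqP; split=> w /=; first by move=> [hA hB] i si; split; [exact: hA|exact: hB].
by move=> h; split=> i si; have [] := h i si.
Qed.

Lemma sub_cylinders (s t : seq I) : {subset s <= t} -> cylinders s `<=` cylinders t.
Proof.
move=> st _ [A [mA ->]]; exists (fun i => if i \in s then A i else setT); split.
  by move=> i; case: ifP.
apply/seteqP; split=> w /= h i; first by case: ifPn => // si _; exact: h.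
by move=> si; have := h i (st _ si); rewrite si.
Qed.

(** Dynkin's argument: the product formula passes from cylinders to complements and disjoint
    countable unions, hence to the sigma-algebra that they generate. *)
Lemma generated_indep (e : I) (s : seq I) (A : set R) (D : set T) :
  e \notin s -> measurable A -> <<s cylinders s >> D ->
  P (X e @^-1` A `&` D) = (P (X e @^-1` A) * P D)%E.
Proof.
move=> es mA; have mXA := measurable_preimage_RV e mA.
pose Q (D : set T) := P (X e @^-1` A `&` D) = (P (X e @^-1` A) * P D)%E.
apply: (@dynkin_induction _ (generated s) (cylinders s) Q) => //.
- exact: setI_closed_cylinders.
- by rewrite /Q setIT probability_setT mule1.
- move=> _ [B [mB ->]]; rewrite /Q.
  (* The family extended by [A] at the index [e]: independence over [e :: undup s] and over
     [undup s] together give the product formula. *)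
  pose B' i := if i == e then A else B i.
  have mB' i : measurable (B' i) by rewrite /B'; case: ifP.
  have h1 := X_indep (undup_uniq s) mB.
  have u : uniq (e :: undup s) by rewrite /= undup_uniq mem_undup es.
  have h2 := X_indep u mB'.
  have eqB (S : Type) (op : S -> S -> S) (x0 : S) (F : set R -> I -> S) :
      \big[op/x0]_(i <- undup s) F (B' i) i = \big[op/x0]_(i <- undup s) F (B i) i.
    rewrite big_seq_cond [RHS]big_seq_cond; apply: eq_bigr => i /andP[].
    rewrite mem_undup /B' => si _; case: eqP => // ie.
    by rewrite -ie si in es.
  rewrite !big_cons in h2.
  rewrite (eqB _ _ _ (fun A i => X i @^-1` A)) in h2.
  rewrite (eqB _ _ _ (fun A i => P (X i @^-1` A))) in h2.
  have Be : B' e = A by rewrite /B' eqxx.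
  by rewrite cylinders_bigI h1; rewrite Be in h2.
- move=> B sB; rewrite /Q => QB; have mB := measurable_generated sB.
  have -> : X e @^-1` A `&` ~` B = X e @^-1` A `\` (X e @^-1` A `&` B).
    by rewrite -setDE setDIr setDv set0U.
  rewrite measureD //; last by rewrite ltey_eq fin_num_measure.
    rewrite setIA setIid [X in (_ - X)%E]QB probability_setC //.
    by rewrite muleBr ?mule1 ?fin_num_measure.
  exact: measurableI.
- move=> F sF tF QF; have mF n := measurable_generated (sF n).
  rewrite /Q setI_bigcupr measure_bigcup //; first last.
  + by apply: trivIset_setIl.
  + by move=> n _; exact: measurableI.
  have [p pE] : exists p, P (X e @^-1` A) = p%:E.
    by exists (fine (P (X e @^-1` A))); rewrite fineK // fin_num_measure.
  rewrite measure_bigcup // pE -nneseriesZl //.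
  by apply: eq_eseriesr => n _; rewrite -pE; exact: QF.
Qed.

(* Given w in the sub-sigma-algebra of the X_i, i in s, the conditional law of X_e
   is still standard normal. *)
Lemma frozen_variable (e : I) (s : seq I) (F : measurableTypeR R * generated s -> \bar R) :
  e \notin s -> measurable_fun setT F -> (forall z, 0 <= F z)%E ->
  (\int[P]_w F (X e w, w) = \int[P]_w \int[normal_prob 0 1]_x F (x, w))%E.
Proof.
move=> es mF F0.
have mid : measurable_fun setT (id : T -> generated s).
  move=> _ D mD; rewrite setTI; exact: (measurable_generated mD).
have mXe0 : measurable_fun [set: T] (X e : T -> R) by exact: measurable_funP.
have mXe : measurable_fun [set: T] (X e : T -> measurableTypeR R) := mXe0.
have mpair := measurable_fun_pair mXe mid.
pose idm : {mfun T >-> generated s} :=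
  HB.pack (id : T -> generated s) (isMeasurableFun.Build _ _ _ _ _ mid).
pose pairm : {mfun T >-> (measurableTypeR R * generated s)%type} :=
  HB.pack (fun w : T => (X e w, id w : generated s))
    (isMeasurableFun.Build _ _ _ _ _ mpair).
transitivity (\int[distribution P pairm]_z F z)%E.
  by rewrite ge0_integral_distribution.
symmetry.
transitivity (\int[normal_prob 0 1 \x distribution P idm]_z F z)%E; last first.
  (* By independence, the joint law of [X e] and of w seen in [generated s] agrees with the product
     measure on measurable rectangles, hence on all measurable sets. *)
  apply: (eq_measure_integral (distribution P pairm)
    (m1 := (normal_prob 0 1 \x distribution P idm)%E)) => A mA _.
  apply: (@product_measure_unique _ _ _ _ _ _ _ (distribution P pairm)) => // B D mB mD.
  transitivity (P (X e @^-1` B) * P D)%E; first exact: (generated_indep es mB mD).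
  by rewrite [P (X e @^-1` B)](X_normal e mB).
rewrite fubini_tonelli2 //.
rewrite ge0_integral_distribution //.
  exact: measurable_fun_fubini_tonelli_G.
by move=> w; apply: integral_ge0 => x _.
Qed.

End FrozenVariable.

Lemma measurable_sum_in d (T : measurableType d) (R : realType) (I : eqType)
    (s : seq I) (h : I -> T -> R) :
  {in s, forall i, measurable_fun setT (h i)} ->
  measurable_fun setT (fun x => \sum_(i <- s) h i x).
Proof.
elim: s => [|i s IH] mh; first by under eq_fun do [rewrite big_nil]; exact: measurable_cst.
under eq_fun do rewrite big_cons.
apply: measurable_funD; first by apply: (mh i); rewrite mem_head.
by apply: IH => j js; apply: (mh j); rewrite inE js orbT.
Qed.

(** * Gaussian sums with random signs *)

Section SignedSums.
Context {d : measure_display} {T : measurableType d} {R : realType}.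
Variable P : probability T R.
Variables (I : eqType) (X : I -> {RV P >-> R}).
Hypothesis X_indep : mutually_independent X.
Hypothesis X_normal : forall i, standard_normal (X i).

Lemma measurable_generated_RV (i : I) (s : seq I) : i \in s ->
  measurable_fun setT (X i : generated X s -> R).
Proof.
move=> si _ A mA; rewrite setTI; apply: sub_sigma_algebra.
exists (fun j => if j == i then A else setT); split.
  by move=> j; case: ifP => _; [exact: mA|exact: measurableT].
apply/seteqP; split=> w /= h; first by move=> j _; case: eqP => // ->.
by have := h i si; rewrite eqxx.
Qed.

Lemma measurable_generated_sub (s t : seq I) (f : T -> R) : {subset s <= t} ->
  measurable_fun setT (f : generated X s -> R) ->
  measurable_fun setT (f : generated X t -> R).
Proof.
move=> st mf _ A mA; have := mf measurableT A mA.
by apply: sub_sigma_algebra2; exact: sub_cylinders.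
Qed.

Lemma generated_measurable_fun (s : seq I) (f : T -> R) :
  measurable_fun setT (f : generated X s -> R) -> measurable_fun setT f.
Proof. by move=> mf _ A mA; exact: (measurable_generated (mf measurableT A mA)). Qed.

(* The variables X_e are integrated out one by one: by the semigroup property, each
   of them adds 1 to the variance a^2. *)
Lemma signed_normal_sum (s t : seq I) (b : I -> T -> R) (a : R) :
  uniq t -> {in t, forall e, e \notin s} ->
  {in t, forall e, measurable_fun setT (b e : generated X s -> R)} ->
  (forall e w, b e w ^+ 2 = 1) -> 0 <= a ->
  (\int[P]_w normal_abs a (\sum_(e <- t) b e w * X e w)%R =
    (Num.sqrt (a ^+ 2 + (size t)%:R) * Num.sqrt (2 / pi))%:E)%E.
Proof.
move=> + + + b1; elim: t a => [|e t IH] a ut ts mb a0.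
  under eq_integral do rewrite big_nil normal_abs0 //.
  have /= P1 := @probability_setT _ _ _ P.
  rewrite (integral_cst P measurableT) /= P1 mule1.
  by rewrite addr0 sqrtr_sqr ger0_norm.
have [et {}ut] : e \notin t /\ uniq t by move: ut => /= /andP.
(* The value of [X e] is made a separate argument: the other variables and all the signs are
   measurable for the indices [t ++ s], which do not contain [e]. *)
pose F (z : measurableTypeR R * generated X (t ++ s)) :=
  normal_abs a (\sum_(i <- t) b i z.2 * X i z.2 + b e z.2 * z.1).
have mbs i : i \in e :: t -> measurable_fun setT (b i : generated X (t ++ s) -> R).
  move=> it; apply: measurable_generated_sub (mb i it) => j js.
  by rewrite mem_cat js orbT.
have mF : measurable_fun setT F.
  apply: measurableT_comp; first exact: measurable_normal_abs.
  apply: measurable_funD; last first.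
    apply: measurable_funM; last exact: measurable_fst.
    by apply: (measurableT_comp (mbs e _)) => //; rewrite mem_head.
  apply: measurable_sum_in => i it; apply: measurable_funM.
    by apply: (measurableT_comp (mbs i _)) => //; rewrite inE it orbT.
  by apply: (measurableT_comp (measurable_generated_RV (s := t ++ s) _)) => //;
    rewrite mem_cat it.
transitivity (\int[P]_w F (X e w, w))%E.
  by apply: eq_integral => w _; rewrite /F big_cons addrC.
rewrite (frozen_variable X_indep X_normal (e := e)) //.
- under eq_integral do rewrite /F /= normal_abs_sign //.
  rewrite IH //.
  + by rewrite sqr_sqrtr ?addr_ge0 ?sqr_ge0 // -addrA nat1r.
  + by move=> i it; apply: ts; rewrite inE it orbT.
  + by move=> i it; apply: mb; rewrite inE it orbT.
- by rewrite mem_cat negb_or et ts // mem_head.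
- by move=> z; exact: normal_abs_ge0.
Qed.

End SignedSums.

(** * Greedy spins *)

Section GreedySpins.
Context {d : measure_display} {T : measurableType d} {R : realType}.
Variable P : probability T R.
Variable g : nat -> nat -> {RV P >-> R}.
Hypothesis g_indep : mutually_independent (fun ij : nat * nat => g ij.1 ij.2).
Hypothesis g_normal : forall i j : nat, standard_normal (g i j).
Local Notation X := (fun ij : nat * nat => g ij.1 ij.2).

Definition block (n : nat) : seq (nat * nat) :=
  [seq (i, j) | i <- iota 0 n, j <- iota 0 n].

(** Together with (n, n), these are the indices that [block n.+1] adds to [block n]. *)
Definition cross (n : nat) : seq (nat * nat) :=
  [seq (i, n) | i <- iota 0 n] ++ [seq (n, i) | i <- iota 0 n].

Definition ising_energy (n : nat) (s : nat -> T -> R) (w : T) : R :=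
  \sum_(i < n) \sum_(j < n) g i j w * (s i w * s j w).

Definition local_field (n : nat) (s : nat -> T -> R) (w : T) : R :=
  \sum_(i < n) (g i n w + g n i w) * s i w.

Lemma mem_block (n i j : nat) : ((i, j) \in block n) = (i < n)%N && (j < n)%N.
Proof.
apply/allpairsP/andP => [[[i' j'] /= []]|[i_n j_n]].
  by rewrite !mem_iota !add0n => /andP[_ ?] /andP[_ ?] [-> ->].
by exists (i, j); rewrite /= !mem_iota.
Qed.

Lemma block_sub (n : nat) : {subset block n <= block n.+1}.
Proof. by move=> [i j]; rewrite !mem_block => /andP[/ltnW i_n /ltnW j_n]; exact/andP. Qed.

Lemma cross_uniq (n : nat) : uniq (cross n).
Proof.
rewrite cat_uniq !map_inj_uniq ?iota_uniq /=; last by move=> i j [].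
  rewrite andbT; apply/hasPn => _ /mapP[i + ->]; rewrite mem_iota => /andP[_ i_n].
  apply/mapP => -[j + [nj _]]; rewrite mem_iota -nj add0n => /andP[_].
  by rewrite ltnn.
by move=> i j [].
Qed.

Lemma cross_block (n : nat) : {in cross n, forall e, e \notin block n}.
Proof.
by move=> e; rewrite mem_cat => /orP[] /mapP[i _ ->];
  rewrite mem_block ltnn ?andbF.
Qed.

Lemma size_cross (n : nat) : size (cross n) = (n + n)%N.
Proof. by rewrite size_cat !size_map size_iota. Qed.

(** On [cross n] one index is n and the other is smaller, so the minimum designates a spin already
    chosen. *)
Lemma local_fieldE (n : nat) (s : nat -> T -> R) (w : T) :
  local_field n s w = \sum_(e <- cross n) s (minn e.1 e.2) w * X e w.
Proof.
rewrite big_cat /= !big_map -big_split /= /local_field.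
rewrite -(big_mkord xpredT (fun i => (g i n w + g n i w) * s i w)) /index_iota subn0.
rewrite big_seq [RHS]big_seq; apply: eq_bigr => i; rewrite mem_iota => /andP[_ i_n].
by rewrite [minn n i]minnC (minn_idPl (ltnW i_n)) -mulrDr mulrC.
Qed.

Lemma ising_energyS (n : nat) (s s' : nat -> T -> R) (w : T) :
  (forall i, (i < n)%N -> s' i w = s i w) ->
  ising_energy n.+1 s' w =
  ising_energy n s w + g n n w * s' n w ^+ 2 + local_field n s w * s' n w.
Proof.
move=> s's; rewrite /ising_energy big_ord_recr /= big_ord_recr /=.
under eq_bigr => i _ do rewrite big_ord_recr /= (s's _ (ltn_ord i)).
rewrite big_split /=.
under [X in X + _ + _ = _]eq_bigr => i _ do
  under eq_bigr => j _ do rewrite (s's _ (ltn_ord j)).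
under [X in _ + (X + _) = _]eq_bigr => j _ do rewrite (s's _ (ltn_ord j)).
have -> : local_field n s w * s' n w =
    \sum_(i < n) g i n w * (s i w * s' n w) + \sum_(i < n) g n i w * (s' n w * s i w).
  rewrite /local_field mulr_suml -big_split; apply: eq_bigr => i _ /=; ring.
ring.
Qed.

Lemma integrable_disorder (i j : nat) :
  P.-integrable setT (fun w => (g i j w)%:E) /\ (\int[P]_w (g i j w)%:E = 0)%E.
Proof.
have mg : measurable_fun [set: T] (g i j : T -> R) by exact: measurable_funP.
have mid : measurable_fun [set: R] (fun x : R => x%:E) by exact/measurable_EFinP.
have law (f : R -> \bar R) : measurable_fun setT f -> (forall x, 0 <= f x)%E ->
    (\int[P]_w f (g i j w) = \int[normal_prob 0 1]_x f x)%E.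
  move=> mf f0.
  have mY : measurable_fun [set: T] (g i j : T -> measurableTypeR R) := mg.
  pose Y : {mfun T >-> measurableTypeR R} :=
    HB.pack (g i j : T -> measurableTypeR R) (isMeasurableFun.Build _ _ _ _ _ mY).
  transitivity (\int[distribution P Y]_x f x)%E.
    by rewrite (ge0_integral_distribution Y mf f0).
  apply: (eq_measure_integral (normal_prob 0 1) (m1 := distribution P Y)) => A mA _.
  exact: g_normal.
have ig : P.-integrable setT (fun w => (g i j w)%:E).
  apply/integrableP; split; first exact/measurable_EFinP.
  rewrite (law (fun x => `|x%:E|%E)) //; last exact: measurableT_comp.
  by rewrite integral_normal_abs ltry.
split => //; have [_ <-] := @integral_normal_id R.
rewrite integralE [RHS]integralE.
rewrite -(law _ (measurable_funepos mid)) // -(law _ (measurable_funeneg mid)) //.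
by congr (_ - _)%E; apply: eq_integral => w _; rewrite ?funeposE ?funenegE.
Qed.

(** The signs depend on [block n] only and [cross n] is disjoint from it, so the 2n terms add up to
    a Gaussian of variance 2n; its mean absolute value is sqrt(2n) sqrt(2/pi). *)
Lemma integral_local_field (n : nat) (s : nat -> T -> R) :
  (forall i, (i < n)%N -> measurable_fun setT (s i : generated X (block n) -> R)) ->
  (forall i w, s i w ^+ 2 = 1) ->
  (\int[P]_w `|local_field n s w|%:E = (2 / Num.sqrt pi * Num.sqrt n%:R)%:E)%E.
Proof.
move=> ms s1.
transitivity (\int[P]_w normal_abs 0
    (\sum_(e <- cross n) s (minn e.1 e.2) w * X e w)%R)%E.
  by apply: eq_integral => w _; rewrite local_fieldE normal_absE0.
rewrite (@signed_normal_sum _ _ _ _ _ _ g_indep _ (block n)) //.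
- rewrite expr0n /= add0r size_cross addnn -mul2n natrM.
  rewrite sqrtrM // sqrtrM // sqrtrV ?pi_ge0 //; congr EFin.
  transitivity (Num.sqrt 2 * Num.sqrt 2 / Num.sqrt pi * Num.sqrt n%:R : R); first ring.
  by rewrite -expr2 sqr_sqrtr.
- exact: cross_uniq.
- exact: cross_block.
- move=> e; rewrite mem_cat => /orP[] /mapP[i + ->]; rewrite mem_iota => /andP[_ i_n] /=.
    by rewrite (minn_idPl (ltnW i_n)); exact: ms.
  by rewrite (minn_idPr (ltnW i_n)); exact: ms.
Qed.

(** Measurability of the spins in [block n] is carried through the induction because it makes the
    next local field Gaussian. The diagonal disorder has mean zero, so each step adds the mean of
    |L_m|. *)
Lemma greedy_spins (n : nat) : exists s : nat -> T -> R,
  [/\ forall i, (i < n)%N -> measurable_fun setT (s i : generated X (block n) -> R),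
      forall i w, s i w ^+ 2 = 1,
      P.-integrable setT (fun w => (ising_energy n s w)%:E) &
      (\int[P]_w (ising_energy n s w)%:E =
        (2 / Num.sqrt pi * \sum_(m < n) Num.sqrt m%:R)%:E)%E].
Proof.
elim: n => [|n [s [ms s1 iU UE]]].
  exists (fun _ _ => 1); split => //.
  - by move=> _ _; rewrite expr1n.
  - by rewrite /ising_energy; under eq_fun do rewrite big_ord0; exact: integrable0.
  - rewrite /ising_energy; under eq_integral do rewrite big_ord0.
    by rewrite integral0 big_ord0 mulr0.
pose L := local_field n s.
(* The new spin has the sign of L, so that its product with L is |L|; at L = 0 it is set to 1 to
   remain a sign. *)
pose s' i w := if i == n then if 0 <= L w then 1 else -1 else s i w.
have s's i w : (i < n)%N -> s' i w = s i w by move=> i_n; rewrite /s' ltn_eqF.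
have s'1 i w : s' i w ^+ 2 = 1.
  by rewrite /s'; case: eqP => // _; case: ifP; rewrite ?sqrrN expr1n.
have msS i : (i < n)%N -> measurable_fun setT (s i : generated X (block n.+1) -> R).
  by move=> i_n; apply: measurable_generated_sub (ms i i_n); exact: block_sub.
have mgS i j : (i < n.+1)%N -> (j < n.+1)%N ->
    measurable_fun setT (g i j : generated X (block n.+1) -> R).
  move=> i_n j_n; apply: (@measurable_generated_RV _ _ _ _ _ X (i, j)).
  by rewrite mem_block i_n.
have mL : measurable_fun setT (L : generated X (block n.+1) -> R).
  apply: measurable_sum => i; apply: measurable_funM; last exact: msS.
  by apply: measurable_funD; apply: mgS => //; rewrite ltnS ltnW.
have mLT := generated_measurable_fun mL.
have ULE w : ising_energy n.+1 s' w = ising_energy n s w + g n n w + `|L w|.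
  rewrite (ising_energyS (s := s)) => [|i i_n]; last exact: s's.
  rewrite s'1 mulr1; congr (_ + _).
  rewrite /s' eqxx -/(L w); case: (lerP 0 (L w)) => L0; first by rewrite mulr1 ger0_norm.
  by rewrite mulrN1 ltr0_norm.
have [ig gE] := integrable_disorder n n.
have LE := integral_local_field ms s1.
have iL : P.-integrable setT (fun w => `|L w|%:E).
  apply/integrableP; split.
    by apply/measurable_EFinP; exact: measurableT_comp.
  under eq_integral do rewrite abse_EFin normr_id.
  by rewrite LE ltry.
have iUg := integrableD measurableT iU ig.
exists s'; split => //.
- move=> i; rewrite ltnS leq_eqVlt => /predU1P[->|i_n].
    rewrite /s' eqxx; apply: measurable_fun_ifT => //.
    exact: measurable_fun_ler.
  by rewrite /s' ltn_eqF //; exact: msS.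
- under eq_fun do rewrite ULE !EFinD.
  exact: integrableD.
- under eq_integral do rewrite ULE !EFinD.
  rewrite integralD // integralD // UE gE adde0 LE -EFinD.
  by rewrite big_ord_recr /= mulrDr.
Qed.

End GreedySpins.

(** * The free energy *)

(** Comparison with the integral of the square root over [0, n]; the last term of the sum is sqrt
    n. *)
Lemma sum_sqrt_ge (R : realType) (n : nat) :
  2 / 3 * (n%:R * Num.sqrt n%:R) <= \sum_(m < n.+1) Num.sqrt m%:R :> R.
Proof.
elim: n => [|n IH]; first by rewrite big_ord1 mul0r mulr0 sqrtr0.
rewrite big_ord_recr /=; apply: le_trans (lerD IH (lexx _)).
set a := Num.sqrt n.+1%:R; set b := Num.sqrt n%:R.
have a2 : n.+1%:R = a ^+ 2 :> R by rewrite sqr_sqrtr.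
have b2 : n%:R = b ^+ 2 :> R by rewrite sqr_sqrtr.
have ab : a ^+ 2 = b ^+ 2 + 1 by rewrite -a2 -b2 -natr1.
have a0 : 0 <= a := sqrtr_ge0 _.
have b0 : 0 <= b := sqrtr_ge0 _.
(* The induction step is 3a >= 2(a^3 - b^3); as a^2 - b^2 = 1, it amounts to a^3 - 3ab^2 + 2b^3 >=
   0, which factors in this way. *)
have key : 0 <= (a - b) ^+ 2 * (a + 2 * b).
  by rewrite mulr_ge0 ?sqr_ge0 // addr_ge0 // mulr_ge0.
have aE : a = a * (a ^+ 2 - b ^+ 2) by rewrite ab addrAC subrr add0r mulr1.
rewrite a2 b2; nra.
Qed.

Lemma powR32 (R : realType) (x : R) : 0 <= x -> x `^ (3 / 2) = x * Num.sqrt x.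
Proof.
move=> x0; rewrite (_ : 3 / 2 = 1 + 2^-1); last by field.
rewrite powRD ?powRr1 ?powR12_sqrt //.
by apply/implyP => /eqP h; exfalso; lra.
Qed.

Section FreeEnergy.
Context {d : measure_display} {T : measurableType d} {R : realType}.
Variable P : probability T R.
Variable g : nat -> nat -> {RV P >-> R}.
Hypothesis g_indep : mutually_independent (fun ij : nat * nat => g ij.1 ij.2).
Hypothesis g_normal : forall i j : nat, standard_normal (g i j).

Lemma log_partition_ge (kappa N : nat) (beta : R) (sigma : {ffun 'I_N -> 'I_kappa}) (w : T) :
  beta * potts_hamiltonian g sigma w <=
  ln (\sum_(tau : {ffun 'I_N -> 'I_kappa}) expR (beta * potts_hamiltonian g tau w)).
Proof.
have le : expR (beta * potts_hamiltonian g sigma w) <=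
    \sum_(tau : {ffun 'I_N -> 'I_kappa}) expR (beta * potts_hamiltonian g tau w).
  by rewrite (bigD1 sigma) //= lerDl sumr_ge0 // => tau _; exact: expR_ge0.
rewrite -ler_expR lnK // posrE; exact: lt_le_trans (expR_gt0 _) le.
Qed.

Lemma potts_hamiltonian_two_colours (kappa N : nat) (c0 c1 : 'I_kappa)
    (s : nat -> T -> R) (w : T) : c0 != c1 -> (forall i, s i w ^+ 2 = 1) ->
  potts_hamiltonian g [ffun i : 'I_N => if s i w == 1 then c0 else c1] w =
  (Num.sqrt N%:R)^-1 / 2 *
    (\sum_(i < N) \sum_(j < N) g i j w + ising_energy g N s w).
Proof.
move=> c01 s1; rewrite /potts_hamiltonian -mulrA; congr (_ * _).
rewrite /ising_energy -big_split mulr_sumr; apply: eq_bigr => i _ /=.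
rewrite -big_split mulr_sumr; apply: eq_bigr => j _ /=.
rewrite !ffunE.
have sP k : s k w = 1 \/ s k w = -1.
  by move/eqP: (s1 k); rewrite sqrf_eq1 => /orP[] /eqP ->; [left|right].
have N11 : (-1 == 1 :> R) = false by apply/negP => /eqP h; lra.
case: (sP i) => ->; case: (sP j) => ->;
  rewrite ?N11 ?eqxx ?(negbTE c01) 1?eq_sym ?(negbTE c01) /=; lra.
Qed.

Lemma potts_free_energy_ge (kappa N : nat) (beta : R) :
  (2 <= kappa)%N -> (1 <= N)%N -> 0 <= beta ->
  ((((N%:R - 1) / N%:R) `^ (3 / 2) * (2 * beta / (3 * Num.sqrt pi)))%:E
     <= potts_free_energy g kappa N beta)%E.
Proof.
case: N => // n k2 _ b0; set N := n.+1.
pose c0 : 'I_kappa := Ordinal (ltnW k2); pose c1 : 'I_kappa := Ordinal k2.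
have [s [_ s1 iU UE]] := greedy_spins g_indep g_normal N.
(* Up to a factor, the part of the two-colour energy that does not involve the spins; it has mean
   zero. *)
pose G w := \sum_(i < N) \sum_(j < N) g i j w.
have iG : P.-integrable setT (fun w => (G w)%:E) /\ (\int[P]_w (G w)%:E = 0)%E.
  have iR i : P.-integrable setT (fun w => (\sum_(j < N) (g i j w)%:E)%E).
    by apply: integrable_sum => // j _; exact: (integrable_disorder g_normal i j).1.
  have GE w : (G w)%:E = (\sum_(i < N) \sum_(j < N) (g i j w)%:E)%E.
    by rewrite /G -sumEFin; apply: eq_bigr => i _; rewrite -sumEFin.
  split; first by under eq_fun do rewrite GE; exact: integrable_sum.
  under eq_integral do rewrite GE.
  rewrite integral_sum // big1 // => i _.
  rewrite integral_sum // => [|j]; last exact: (integrable_disorder g_normal i j).1.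
  by rewrite big1 // => j _; exact: (integrable_disorder g_normal i j).2.
pose c := beta * ((Num.sqrt N%:R)^-1 / 2).
rewrite /potts_free_energy unlock.
(* For each w the partition function is bounded below by its term at the greedy colouring, which
   depends on w. *)
apply: (@le_trans _ _ (N%:R^-1%:E * \int[P]_w (c * (G w + ising_energy g N s w))%:E)%E);
    last first.
  apply: lee_wpmul2l; first by rewrite lee_fin.
  apply: integral_mono => w; rewrite lee_fin.
  rewrite /c -mulrA -(@potts_hamiltonian_two_colours _ _ c0 c1) //.
  exact: log_partition_ge.
under eq_integral do rewrite EFinM EFinD.
rewrite integralZl //; last exact: (integrableD measurableT iG.1 iU).
rewrite (integralD measurableT iG.1 iU) iG.2 UE add0e -!EFinM lee_fin.
(* Since N = n + 1, the sum of the square roots is at least 2/3 (N - 1)^(3/2). *)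
have := @sum_sqrt_ge R n; set S := \sum_(m < _) _ => HS.
have N0 : 0 < N%:R :> R by rewrite ltr0n.
have q0 : 0 < Num.sqrt N%:R :> R by rewrite sqrtr_gt0.
have p0 : 0 < Num.sqrt pi :> R by rewrite sqrtr_gt0 pi_gt0.
have nE : N%:R - 1 = n%:R :> R by rewrite -natr1 addrK.
rewrite nE powR32 ?divr_ge0 // sqrtrM // sqrtrV //.
have -> : n%:R / N%:R * (Num.sqrt n%:R / Num.sqrt N%:R) * (2 * beta / (3 * Num.sqrt pi)) =
    beta / (N%:R * Num.sqrt N%:R * Num.sqrt pi) *
    (2 / 3 * (n%:R * Num.sqrt n%:R)) :> R.
  by field; rewrite ?gt_eqF.
have -> : N%:R^-1 * (c * (2 / Num.sqrt pi * S)) =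
    beta / (N%:R * Num.sqrt N%:R * Num.sqrt pi) * S :> R.
  by rewrite /c; field; rewrite ?gt_eqF.
by rewrite ler_wpM2l // divr_ge0 // !mulr_ge0 // ltW.
Qed.

End FreeEnergy.

(** * The Parisi functional *)

Section GaussianMoments.
Context {R : realType}.
Local Notation N01 := (@normal_prob R 0 1).

(** Completing the square: exp(s t) times the standard density is exp(s^2 / 2) times the density
    with mean s. *)
Lemma integral_normal_expR (s : R) :
  (\int[N01]_t (expR (s * t))%:E = (expR (s ^+ 2 / 2))%:E)%E.
Proof.
have me : measurable_fun setT (fun t : R => (expR (s * t))%:E).
  by apply/measurable_EFinP; apply: measurableT_comp.
rewrite ge0_integral_normal_prob //.
transitivity (\int[lebesgue_measure]_t
    ((expR (s ^+ 2 / 2))%:E * (normal_pdf s 1 t)%:E))%E.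
  apply: eq_integral => t _; rewrite -!EFinM; congr EFin.
  rewrite !normal_pdf_gt0E // mulrCA [RHS]mulrCA -!expRD; congr (_ * expR _).
  by field.
rewrite ge0_integralZl //.
- by rewrite integral_normal_pdf mule1.
- by apply/measurable_EFinP; exact: measurable_normal_pdf.
- by move=> t _; rewrite lee_fin normal_pdf_ge0.
Qed.

Lemma integral_normal_exp_sum (I : finType) (a : R) (b s : I -> R) :
  0 <= a -> (forall k, 0 <= b k) ->
  (\int[N01]_t (a + \sum_k b k * expR (s k * t))%:E =
    (a + \sum_k b k * expR (s k ^+ 2 / 2))%:E)%E.
Proof.
move=> a0 b0.
have me k : measurable_fun setT (fun t : R => (expR (s k * t))%:E).
  by apply/measurable_EFinP; apply: measurableT_comp.
have be0 k t : (0 <= (b k)%:E * (expR (s k * t))%:E)%E.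
  by rewrite mule_ge0 // lee_fin // expR_ge0.
have mbe k : measurable_fun setT (fun t : R => (b k)%:E * (expR (s k * t))%:E)%E.
  exact: emeasurable_funM.
transitivity (\int[N01]_t (a%:E + \sum_k (b k)%:E * (expR (s k * t))%:E))%E.
  by apply: eq_integral => t _; rewrite EFinD -sumEFin.
rewrite ge0_integralD //; last 2 first.
- by move=> t _; exact: sume_ge0.
- exact: emeasurable_sum.
rewrite ge0_integral_sum // EFinD -sumEFin; congr (_ + _)%E.
  have /= N1 := @probability_setT _ _ _ N01.
  by rewrite (integral_cst N01 measurableT) /= N1 mule1.
apply: eq_bigr => k _; rewrite ge0_integralZl //.
- by rewrite integral_normal_expR.
- exact: me.
- by rewrite lee_fin.
Qed.

(** The form of the bound is stable under integration of one coordinate, so the coordinates are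
    removed in turn. The variance of (v A)_k is the squared norm of the k-th column of A, whence the
    exponent. *)
Lemma std_gauss_expectation_le (n kappa : nat) (A : 'M[R]_(n, kappa)) (beta a : R)
    (b : 'I_kappa -> R) (f : 'rV[R]_n -> R) :
  0 <= a -> (forall k, 0 <= b k) ->
  (forall v, 0 <= f v <= a + \sum_k b k * expR (beta * (v *m A) 0 k)) ->
  0 <= std_gauss_expectation f <=
    a + \sum_k b k * expR (beta ^+ 2 / 2 * \sum_i A i k ^+ 2).
Proof.
move=> a0; elim: n A b f => [|n IH] A b f b0 fb.
  rewrite /=; have := fb 0; congr (_ <= _ <= _ + _); apply: eq_bigr => k _.
  by rewrite mul0mx mxE big_ord0 !mulr0.
pose A' : 'M[R]_(1 + n, kappa) := A.
have mulE t (v : 'rV[R]_n) :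
    row_mx (t%:M : 'rV[R]_1) v *m A' = t *: usubmx A' + v *m dsubmx A'.
  by rewrite -[in LHS](vsubmxK A') mul_row_col mul_scalar_mx.
pose S k := \sum_i dsubmx A' i k ^+ 2.
have AS k : \sum_i A i k ^+ 2 = A' 0 k ^+ 2 + S k.
  rewrite big_ord_recl; congr (_ + _); apply: eq_bigr => i _.
  by rewrite mxE; congr (A _ _ ^+ 2); apply/val_inj.
pose h t := std_gauss_expectation (fun v : 'rV[R]_n => f (row_mx (t%:M : 'rV[R]_1) v)).
pose b' k := b k * expR (beta ^+ 2 / 2 * S k).
have b'0 k : 0 <= b' k by rewrite mulr_ge0 // expR_ge0.
have hb t : 0 <= h t <= a + \sum_k b' k * expR (beta * A' 0 k * t).
  have := IH (dsubmx A') (fun k => b k * expR (beta * A' 0 k * t))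
    (fun v : 'rV[R]_n => f (row_mx (t%:M : 'rV[R]_1) v)).
  rewrite (eq_bigr (fun k => b' k * expR (beta * A' 0 k * t))).
    apply; first by move=> k; rewrite mulr_ge0 // expR_ge0.
    move=> v; have := fb (row_mx (t%:M : 'rV[R]_1) v).
    congr (_ <= _ <= _ + _); apply: eq_bigr => k _.
    rewrite -mulrA -expRD; congr (_ * expR _).
    have mE : (row_mx (t%:M : 'rV[R]_1) v : 'rV[R]_n.+1) *m A =
        t *: usubmx A' + v *m dsubmx A' := mulE t v.
    rewrite mE !mxE mulrDr; congr (_ + _).
    by rewrite [t * _]mulrC mulrA; congr (_ * A' _ _ * _); exact/val_inj.
  by move=> k _; rewrite /b' mulrAC.
have hE := integral_normal_exp_sum (fun k => beta * A' 0 k) a0 b'0.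
have -> : a + \sum_k b k * expR (beta ^+ 2 / 2 * \sum_i A i k ^+ 2) =
    a + \sum_k b' k * expR ((beta * A' 0 k) ^+ 2 / 2).
  congr (_ + _); apply: eq_bigr => k _; rewrite /b' -[RHS]mulrA -expRD AS.
  by congr (_ * expR _); field.
have h0 : (0 <= \int[N01]_t (h t)%:E)%E.
  by apply: integral_ge0 => t _; rewrite lee_fin; case/andP: (hb t).
have hle : (\int[N01]_t (h t)%:E <= (a + \sum_k b' k * expR ((beta * A' 0 k) ^+ 2 / 2))%:E)%E.
  by rewrite -hE; apply: integral_mono => t; rewrite lee_fin; case/andP: (hb t).
(* The real-valued expectation is [fine] of an extended integral, which [hle] shows to be finite. *)
change (0 <= fine (\int[N01]_t (h t)%:E) <= a + \sum_k b' k * expR ((beta * A' 0 k) ^+ 2 / 2)).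
rewrite fine_ge0 //= -lee_fin fineK // ge0_fin_numE //.
exact: le_lt_trans hle (ltry _).
Qed.

End GaussianMoments.

(** * One-step paths with a jump close to 1 *)

Section ParisiUpperBound.
Context {R : realType}.

(* When F has no limit, [lim F] is the default value [0], which is harmless here:
   hence the continuity of the Parisi functional at a step path is not needed. *)
Lemma lim_le (F : set_system R) (v B : R) :
  (forall A, F A -> A v) -> v <= B -> 0 <= B -> lim F <= B.
Proof.
move=> Fv vB B0; rewrite /lim /lim_in; case: xgetP => [l _ Fl|_]; last exact: B0.
(* A neighbourhood of l and one of v always meet, at v itself, so Hausdorff separation identifies
   the two points. *)
suff -> : l = v by exact: vB.
apply: (@Rhausdorff R) => A U lA vU; exists v; split; last exact: nbhs_singleton vU.
exact: Fv (Fl _ lA).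
Qed.

(** The tangent to exp at x L lies below exp at L ([h1]) and at 0 ([h2]); averaging with weights x
    and 1 - x gives convexity. *)
Lemma expR_convex01 (x L : R) : 0 <= x <= 1 ->
  expR (x * L) <= 1 - x + x * expR L.
Proof.
move=> /andP[x0 x1]; set e := expR (x * L).
have e0 : 0 < e := expR_gt0 _.
have h1 : e * (1 + (1 - x) * L) <= expR L.
  have -> : expR L = e * expR ((1 - x) * L) by rewrite -expRD; congr expR; ring.
  by rewrite ler_pM2l // expR_ge1Dx.
have h2 : e * (1 - x * L) <= 1.
  have E : 1 = e * expR (- (x * L)) by rewrite -expRD subrr expR0.
  by rewrite [leRHS]E ler_pM2l // expR_ge1Dx.
have := ler_wpM2l x0 h1; have : 0 <= 1 - x by lra.
move=> /ler_wpM2l /(_ _ _ h2); nra.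
Qed.

Variable kappa : nat.
Hypothesis kappa_gt0 : (0 < kappa)%N.

Lemma psdmx_scalar_diag (c : R) : 0 <= c -> psdmx (diag_mx (const_mx c : 'rV[R]_kappa)).
Proof.
move=> c0; split; first exact: tr_diag_mx.
move=> v; rewrite mul_mx_diag mxE sumr_ge0 // => k _.
by rewrite !mxE mulrAC mulr_ge0 // -expr2 sqr_ge0.
Qed.

Lemma psdmx0 : psdmx (0 : 'M[R]_kappa).
Proof. by split; [exact: trmx0|move=> v; rewrite mulmx0 mul0mx mxE]. Qed.

Local Notation unif := (const_mx kappa%:R^-1 : 'rV[R]_kappa).
Local Notation D := (diag_mx unif).

Definition one_step (x : R) : step_data kappa :=
  StepData 1 (fun p => if p == 0%N then x else 1) (fun p => if p == 0%N then 0 else D).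

Lemma psdmx_unif : psdmx D.
Proof. by apply: psdmx_scalar_diag; rewrite invr_ge0. Qed.

Lemma one_step_valid (x : R) : 0 < x < 1 -> step_valid unif (one_step x).
Proof.
move=> /andP[x0 x1]; split => //=.
- by split; [exact: ltW|case].
- split; first by case=> [|p] _ /=; [exact: psdmx0|exact: psdmx_unif].
  by case=> //= _; rewrite subr0; exact: psdmx_unif.
Qed.

Lemma one_step_pathE (x u : R) :
  step_path (one_step x) u = if u <= x then 0 else D.
Proof. by rewrite /step_path /=; case: (u <= x). Qed.

Lemma one_step_path_set (x : R) : 0 < x < 1 -> path_set unif (step_path (one_step x)).
Proof.
move=> /andP[x0 x1]; split.
- by move=> u _; rewrite one_step_pathE; case: ifP => _; [exact: psdmx0|exact: psdmx_unif].
- move=> u _; apply: cvg_near_cst.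
  case: (leP u x) => ux; near=> v; rewrite !one_step_pathE.
    rewrite ux ifT //; apply: le_trans ux; apply: ltW; near: v.
    exact: nbhs_left_lt.
  rewrite (leNgt u) ux /= leNgt ifF //; apply/negbTE; rewrite negbK; near: v.
  exact: nbhs_left_gt.
- move=> u v _ uv _; rewrite !one_step_pathE.
  case: (leP v x) => vx; first by rewrite (le_trans uv vx) subr0; exact: psdmx0.
  by case: ifP => _; rewrite ?subr0 ?subrr; [exact: psdmx_unif|exact: psdmx0].
- by rewrite one_step_pathE ltW.
- by rewrite one_step_pathE leNgt x1.
Unshelve. all: by end_near. Qed.

Lemma path_dist_refl (q : R -> 'M[R]_kappa) : path_dist q q = 0%E.
Proof.
rewrite /path_dist; under eq_integral do rewrite subrr.
have -> : hs_norm (0 : 'M[R]_kappa) = 0.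
  rewrite /hs_norm /hs_norm2 big1 ?sqrtr0 // => k _.
  by rewrite big1 // => l _; rewrite mxE expr0n.
exact: integral0.
Qed.

Lemma hs_norm2_unif : hs_norm2 D = kappa%:R^-1.
Proof.
rewrite /hs_norm2 (eq_bigr (fun _ => kappa%:R^-1 ^+ 2)) => [|k _].
  rewrite sumr_const card_ord -mulr_natl; field.
  by rewrite pnatr_eq0 -lt0n.
rewrite (bigD1 k) //= big1 ?addr0 => [|l lk]; rewrite !mxE ?eqxx ?mulr1n //.
by rewrite eq_sym (negbTE lk) mulr0n expr0n.
Qed.

(** Any root [A] of the covariance has columns of squared norm 2 / kappa, so the bound does not
    depend on the one that [xget] picks. *)
Lemma gauss_expectation_le (beta a b : R) (f : 'rV[R]_kappa -> R) :
  0 <= a -> 0 <= b ->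
  (forall z, 0 <= f z <= a + b * \sum_k expR (beta * z 0 k)) ->
  0 <= gauss_expectation (2%:R *: D) f <=
    a + b * (kappa%:R * expR (beta ^+ 2 / kappa%:R)).
Proof.
move=> a0 b0 fb; rewrite /gauss_expectation; set A := xget _ _.
have AE : A^T *m A = 2%:R *: D.
  rewrite /A; apply: (@xgetPex _ 0 [set A : 'M[R]_kappa | A^T *m A = 2%:R *: D]).
  (* A multiple of the identity is a root, so [xget] does not fall back on its default 0. *)
  exists (Num.sqrt (2 / kappa%:R))%:M.
  rewrite /= tr_scalar_mx -scalar_mxM -expr2 sqr_sqrtr ?divr_ge0 //.
  by rewrite diag_const_mx scale_scalar_mx.
have := @std_gauss_expectation_le R kappa kappa A beta a (fun _ => b)
  (fun xi => f (xi *m A)) a0 (fun _ => b0).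
rewrite (eq_bigr (fun _ => b * expR (beta ^+ 2 / kappa%:R))); last first.
  move=> k _; congr (_ * expR _).
  have -> : \sum_i A i k ^+ 2 = 2 / kappa%:R.
    have /matrixP/(_ k k) := AE; rewrite !mxE eqxx mulr1n => <-.
    by apply: eq_bigr => i _; rewrite mxE expr2.
  by rewrite mulrA mulfVK.
rewrite sumr_const card_ord -[_ *+ kappa]mulr_natl mulrCA; apply => v.
by rewrite -mulr_sumr; exact: fb.
Qed.

(** X_0 is (1/x) log E S^x, where S is the sum of the exp(beta z_k), of mean kappa exp(beta^2 /
    kappa). Concavity of S^x, used through an affine majorant, bounds X_0 by the logarithm of that
    mean. *)
Lemma parisi_step_one_step (beta x : R) : 0 < x < 1 ->
  parisi_step beta unif 0 (one_step x) <=
  ln kappa%:R + beta ^+ 2 / kappa%:R - x * (beta ^+ 2 / (2 * kappa%:R)).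
Proof.
move=> /andP[x0 x1].
set lc := ln kappa%:R + beta ^+ 2 / kappa%:R.
have k0 : 0 < kappa%:R :> R by rewrite ltr0n.
have lc0 : 0 <= lc.
  by rewrite addr_ge0 ?ln_ge0 ?ler1n // divr_ge0 // sqr_ge0.
have hs0 : hs_norm2 (0 : 'M[R]_kappa) = 0.
  by rewrite /hs_norm2 big1 // => k _; rewrite big1 // => l _; rewrite mxE expr0n.
rewrite /parisi_step big_ord1 /= hs_norm2_unif hs0 subr0.
rewrite (gt_eqF x0) subr0 [X in _ - X - _]big1 ?subr0; last first.
  by move=> k _; rewrite mxE mul0r.
apply: lerB; last by rewrite le_eqVlt; apply/orP; left; apply/eqP; field; rewrite gt_eqF.
set f := fun z : 'rV[R]_kappa => expR _.
pose C := expR (x * lc).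
(* The majorant is the tangent to S^x at S = exp lc; it comes from [expR_convex01] with L = ln S -
   lc. *)
have fb z : 0 <= f z <= C * (1 - x) + C * x / expR lc * \sum_k expR (beta * z 0 k).
  rewrite expR_ge0 /= /f.
  rewrite (eq_bigr (fun k => expR (beta * z 0 k))) => [|k _]; last first.
    by rewrite !mxE !add0r.
  set S := \sum_k _.
  have S0 : 0 < S.
    rewrite /S (bigD1 (Ordinal kappa_gt0)) //= ltr_wpDr ?expR_gt0 //.
    by apply: sumr_ge0 => k _; exact: expR_ge0.
  have -> : x * ln S = x * lc + x * (ln S - lc) by ring.
  have x01 : 0 <= x <= 1 by rewrite (ltW x0) (ltW x1).
  have SE : expR (ln S - lc) = S / expR lc by rewrite expRD expRN lnK.
  have := expR_convex01 (ln S - lc) x01; rewrite SE => h.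
  have -> : C * (1 - x) + C * x / expR lc * S = C * (1 - x + x * (S / expR lc)).
    by field; rewrite gt_eqF ?expR_gt0.
  by rewrite expRD -/C ler_pM2l ?expR_gt0.
have C0 : 0 < C := expR_gt0 _.
have a0 : 0 <= C * (1 - x) by rewrite mulr_ge0 ?subr_ge0 // ltW.
have b0 : 0 <= C * x / expR lc.
  by rewrite divr_ge0 ?expR_ge0 // mulr_ge0 // ltW.
have /andP[E0] := gauss_expectation_le a0 b0 fb.
have cE : kappa%:R * expR (beta ^+ 2 / kappa%:R) = expR lc by rewrite expRD lnK // posrE.
rewrite cE divfK ?gt_eqF ?expR_gt0 //.
have -> : C * (1 - x) + C * x = C by ring.
rewrite ler_pdivrMl //.
set E := gauss_expectation _ _ in E0 *; move=> EC.
(* If the expectation were 0, the convention ln 0 = 0 would still give the bound, since lc >= 0. *)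
move: E0; rewrite le_eqVlt => /predU1P[<-|E0].
  by rewrite ln0 // mulr_ge0 // ltW.
by rewrite -[leRHS]expRK -/C ler_ln.
Qed.

Lemma parisi_inf_le (beta : R) :
  (parisi_inf beta unif <= (ln kappa%:R + beta ^+ 2 / (2 * kappa%:R))%:E)%E.
Proof.
set B := ln _ + _; set K := beta ^+ 2 / (2 * kappa%:R).
have k0 : 0 < kappa%:R :> R by rewrite ltr0n.
have K0 : 0 <= K by rewrite divr_ge0 ?sqr_ge0 // mulr_ge0.
have B0 : 0 <= B by rewrite addr_ge0 // ln_ge0 // ler1n.
apply/lee_addgt0Pr => e e0.
(* The one-step bound at x = 1 - t is B + t K; this t lies in (0, 1) and makes t K at most e. *)
pose t := e / (e + K + 1).
have D0 : 0 < e + K + 1 by lra.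
have t01 : 0 < 1 - t < 1.
  rewrite subr_gt0 ltrBlDr ltrDl /t divr_gt0 // andbT ltr_pdivrMr //; lra.
have tK : t * K <= e.
  by rewrite /t mulrAC ler_pdivrMr //; nra.
apply: (@le_trans _ _ (parisi beta unif (step_path (one_step (1 - t))))).
  by apply: ereal_inf_lbound; exists (step_path (one_step (1 - t))) => //;
    exact: one_step_path_set.
apply: (@le_trans _ _ (parisi_lambda beta unif 0 (step_path (one_step (1 - t))))%:E).
  by apply: ereal_inf_lbound; exists 0.
(* The step data belong to every neighbourhood of their own path, being at distance 0, so [lim_le]
   applies with their value. *)
rewrite -EFinD lee_fin; apply: (@lim_le _ (parisi_step beta unif 0 (one_step (1 - t)))).
- move=> A [r /= r0]; apply; split; first exact: one_step_valid.
  by rewrite path_dist_refl lte_fin.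
- apply: le_trans (parisi_step_one_step beta t01) _.
  rewrite -/K (_ : beta ^+ 2 / kappa%:R = 2 * K); last first.
    by rewrite /K; field; rewrite gt_eqF.
  by rewrite /B -/K; nra.
- by rewrite addr_ge0 // ltW.
Qed.

End ParisiUpperBound.

(** * The gap *)

(** Completing the square in beta: the right side minus the left side is 2k / (9 pi) times the same
    difference in the hypothesis. *)
Lemma parisi_gap (R : realType) (k l beta : R) : 0 < k ->
  `|3 * Num.sqrt pi / (2 * k) * beta - 1| ^+ 2 < 1 - 9 * pi * l / (2 * k) ->
  l + beta ^+ 2 / (2 * k) < 2 * beta / (3 * Num.sqrt pi).
Proof.
move=> k0; rewrite real_normK ?num_real // -subr_gt0 => h.
set p := Num.sqrt pi in h *.
have p0 : 0 < p by rewrite sqrtr_gt0 pi_gt0.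
have piE : pi = p ^+ 2 by rewrite sqr_sqrtr ?pi_ge0.
rewrite -subr_gt0; rewrite piE in h.
rewrite (_ : _ - _ = 2 * k / (9 * p ^+ 2) *
    (1 - 9 * p ^+ 2 * l / (2 * k) - (3 * p / (2 * k) * beta - 1) ^+ 2)).
  by rewrite mulr_gt0 // divr_gt0 ?mulr_gt0 // exprn_gt0.
by field; rewrite !gt_eqF.
Qed.

(** With x = 1 - 1/N in [0, 1], x^(3/2) >= x^2 >= 1 - 2/N, which tends to 1; this gives the
    threshold 2C / (C - c) on N. *)
Lemma near_powR32 (R : realType) (c C : R) : 0 <= C -> c < C ->
  \forall N \near \oo, (1 <= N)%N /\ c <= ((N%:R - 1) / N%:R) `^ (3 / 2) * C.
Proof.
move=> C0 cC; near=> N.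
have N1 : (1 <= N)%N by near: N; exists 1%N.
have N0 : 0 < N%:R :> R by rewrite ltr0n.
split => //.
have hN : 2 * C / (C - c) <= N%:R by near: N; exact: nbhs_infty_ger.
set x := (N%:R - 1) / N%:R.
have xE : x = 1 - N%:R^-1 by rewrite /x mulrBl mulfV ?gt_eqF // mul1r.
have i0 : 0 < (N%:R : R)^-1 by rewrite invr_gt0.
have i1 : (N%:R : R)^-1 <= 1 by rewrite invf_le1 // ler1n.
have x0 : 0 <= x by rewrite xE subr_ge0.
have x1 : x <= 1 by rewrite xE; lra.
have xs : x <= Num.sqrt x.
  by rewrite -[leLHS]ger0_norm // -sqrtr_sqr ler_wsqrtr // expr2 ler_piMl.
rewrite powR32 //.
have sq : 1 - 2 * N%:R^-1 <= x * Num.sqrt x.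
  apply: (@le_trans _ _ (x * x)); last exact: ler_wpM2l.
  by rewrite xE; nra.
apply: le_trans (ler_wpM2r C0 sq).
have hN' : 2 * C * N%:R^-1 <= C - c.
  by move: hN; rewrite ler_pdivrMr ?subr_gt0 // ler_pdivrMr // [N%:R * _]mulrC.
nra.
Unshelve. all: by end_near. Qed.

Theorem theorem2 (R : realType) (d : measure_display) (T : measurableType d)
    (P : probability T R) (g : nat -> nat -> {RV P >-> R})
    (g_indep : mutually_independent (fun ij : nat * nat => g ij.1 ij.2))
    (g_normal : forall i j : nat, standard_normal (g i j))
    (kappa : nat) (kappa_ge2 : (2 <= kappa)%N) :
  (forall (N : nat) (beta : R), (1 <= N)%N -> 0 <= beta ->
     ((((N%:R - 1) / N%:R) `^ (3 / 2) * (2 * beta / (3 * Num.sqrt pi)))%:E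
        <= potts_free_energy g kappa N beta)%E /\
     (parisi_inf beta (const_mx kappa%:R^-1 : 'rV[R]_kappa)%R
        <= (ln kappa%:R + beta ^+ 2 / (2 * kappa%:R))%:E)%E) /\
  (forall beta : R, 0 <= beta ->
     9 * pi / 2 < kappa%:R / ln (kappa%:R : R) ->
     `|3 * Num.sqrt pi / (2 * kappa%:R) * beta - 1| ^+ 2
       < 1 - 9 * pi * ln kappa%:R / (2 * kappa%:R) ->
     ~ (potts_free_energy g kappa N beta @[N --> \oo] -->
          parisi_inf beta (const_mx kappa%:R^-1 : 'rV[R]_kappa)%R)).
Proof.
have kappa_gt0 := ltnW kappa_ge2.
split=> [N beta N1 b0|beta b0 _ hb FP].
  by split; [exact: potts_free_energy_ge|exact: parisi_inf_le].
have k0 : 0 < kappa%:R :> R by rewrite ltr0n.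
have := parisi_gap k0 hb; set B := _ + _; set C := 2 * beta / _ => BC.
have C0 : 0 <= C by rewrite divr_ge0 ?mulr_ge0 // sqrtr_ge0.
(* The free energies are eventually at least the midpoint of B and C, hence so is their limit; but
   the infimum is at most B. *)
have mC : (B + C) / 2 < C by lra.
have Bm : B < (B + C) / 2 by lra.
suff : (((B + C) / 2)%:E <= B%:E)%E by rewrite lee_fin leNgt Bm.
apply: le_trans (parisi_inf_le kappa_gt0 beta).
apply: (cvge_to_ge FP); near=> N.
have [N1 cN] : (1 <= N)%N /\ (B + C) / 2 <= ((N%:R - 1) / N%:R) `^ (3 / 2) * C.
  by near: N; exact: near_powR32.
by apply: le_trans (potts_free_energy_ge g_indep g_normal kappa_ge2 N1 b0); rewrite lee_fin.
Unshelve. all: by end_near. Qed.
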